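(* For every $n\ge2$ and every graph $G^*$ on $n$ vertices with at most one loop per vertex, \[\lambda_2(G^* )-\lambda_n(G^* )\le\frac{n}{\sqrt2},\] with equality if and only if $G^*$ is isomorphic to the $t$-blowup $P_4^*(t)$ of the closed path $P_4^*$ for some positive integer $t$ (so $n=4t$). In particular, $s_{1,0}=\frac1{\sqrt2}$.
   Context: A graph with at most one loop per vertex on vertex set $\{1,\dots,n\}$ is identified with its adjacency matrix $A=(a_{uv})$, a symmetric $n\times n$ $(0,1)$-matrix where $a_{uv}=1$ iff $uv$ is an edge and $a_{uu}=1$ iff there is a loop at $u$. Its eigenvalues are listed as $\lambda_1\ge\cdots\ge\lambda_n$. The closed path $P_4^*$ is the path $v_1v_2v_3v_4$ with a loop at each of the two endpoints $v_1,v_4$ and no loops at $v_2,v_3$; its adjacency matrix is $\begin{pmatrix}1&1&0&0\\1&0&1&0\\0&1&0&1\\0&0&1&1\end{pmatrix}$. The $t$-blowup $G^*(t)$ of a graph $G^*$ with adjacency matrix $A$ is the graph with adjacency matrix $A\otimes J_t$, where $J_t$ is the $t\times t$ all-ones matrix. For a simple graph $G$ on $n$ vertices, ${\rm spread}_{i,j}(G)=\lambda_{i+1}(G)-\lambda_{n-j}(G)$; ${\rm spread}_{i,j}(n)$ is its maximum over simple graphs on $n$ vertices and $s_{i,j}=\lim_{n\to\infty}{\rm spread}_{i,j}(n)/n$ (known to exist). *)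

(* Defs.v *)
From HB Require Import structures.
From mathcomp Require Import all_boot all_order all_algebra all_fingroup.
From mathcomp Require Import polyrcf.
From mathcomp Require Import all_classical all_reals all_analysis.
Set Implicit Arguments. Unset Strict Implicit. Unset Printing Implicit Defensive.
Import Order.TTheory GRing.Theory Num.Theory.
Local Open Scope ring_scope.

Definition adjmx (R : nzRingType) (n : nat) (e : rel 'I_n) : 'M[R]_n :=
  \matrix_(i < n, j < n) (e i j)%:R.

(* The eigenvalues of a square matrix over a real closed field, listed with
   multiplicity (as roots of the characteristic polynomial) in non-increasing
   order: eigs A = [:: lambda_1; lambda_2; ...; lambda_n] when the
   characteristic polynomial splits over R (always true for real symmetric
   matrices).  lambda_k is (eigs A)`_(k-1). *)
Definition eigs (R : rcfType) (n : nat) (A : 'M[R]_n) : seq R :=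
  let p := char_poly A in
  rev (flatten [seq nseq (mup x p) x | x <- rootsR p]).

Definition lam (R : rcfType) (n : nat) (e : rel 'I_n) (k : nat) : R :=
  (eigs (adjmx R e))`_(k.-1).

(* Adjacency relation of the closed path P_4^* on vertices 0,1,2,3
   (v_1..v_4 of the paper): path 0-1-2-3 with loops at 0 and 3. *)
Definition p4star (a b : nat) : bool :=
  [|| (a == 0%N) && (b == 0%N), (a == 3%N) && (b == 3%N),
      a.+1 == b | b.+1 == a].

(* The t-blowup P_4^*(t), with adjacency matrix A (x) J_t, on vertex set
   'I_(4t): vertex a*t + b (a < 4, b < t) lies in block a. *)
Definition p4star_blowup (t : nat) (i j : nat) : bool :=
  p4star (i %/ t) (j %/ t).

Definition simple_graph (n : nat) (e : rel 'I_n) : bool :=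
  [forall i, ~~ e i i] && [forall i, forall j, e i j == e j i].

Definition spread10 (R : rcfType) (n : nat) (e : rel 'I_n) : R :=
  lam R e 2 - lam R e n.

(* spread_{1,0}(n): maximum over all simple graphs on n vertices
   (max folded from 0; spread_{1,0}(G) >= 0 for n >= 2). *)
Definition spread10n (R : rcfType) (n : nat) : R :=
  \big[Num.max/0]_(g : {ffun 'I_n * 'I_n -> bool}
                    | simple_graph (fun i j => g (i, j)))
     spread10 R (fun i j => g (i, j)).

(* Main.v *)
Require Import Defs.
From HB Require Import structures.
From mathcomp Require Import all_boot all_order all_algebra all_fingroup.
From mathcomp Require Import polyrcf complex spectral.
From mathcomp Require Import all_classical all_reals all_analysis.
From mathcomp Require Import ring lra zify.
Import Order.TTheory GRing.Theory Num.Theory numFieldNormedType.Exports.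
Set Implicit Arguments. Unset Strict Implicit. Unset Printing Implicit Defensive.
Local Open Scope classical_set_scope.
Local Open Scope ring_scope.

(** Write the adjacency matrix as [A = (B + J) / 2] with [J] the all-ones matrix
    and [B] a matrix of signs. By Courant-Fischer there is a unit vector [x]
    orthogonal to the all-ones vector with [lambda_2 <= x A x^T]; let [y] be a
    unit eigenvector for [lambda_n]. Then [2 (lambda_2 - lambda_n)] is at most
    the Frobenius product of [B] and [x^T x - y^T y], and Cauchy-Schwarz bounds
    it by [n sqrt 2], since [B] has norm [n] and [x^T x - y^T y] at most
    [sqrt 2]. In case of equality [B] is proportional to [x^T x - y^T y], and
    [x] and [y] have zero sum: [B] is a sign matrix of rank two with zero row
    sums and zero trace, which forces the four blocks of [P_4^*(t)].
    Conversely, compressing [P_4^*(t)] to the functions constant on blocks gives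
    [t] times the matrix of [P_4^*]. Eigenvalue interlacing for induced
    subgraphs, and the fact that deleting all loops costs at most one in the
    spread, carry the extremal value over to simple graphs on any number of
    vertices up to a bounded error. *)

Definition mxdot (R : pzRingType) (m n : nat) (A B : 'M[R]_(m, n)) : R :=
  \tr (A *m B^T).

Definition qform (R : pzRingType) (n : nat) (A : 'M[R]_n) (x : 'rV[R]_n) : R :=
  mxdot (x *m A) x.

Section FrobeniusProduct.
Variable R : comPzRingType.

Lemma mxdotE (m n : nat) (A B : 'M[R]_(m, n)) :
  mxdot A B = \sum_i \sum_j A i j * B i j.
Proof.
by apply: eq_bigr => i _; rewrite mxE; apply: eq_bigr => j _; rewrite mxE.
Qed.

Lemma mxdotC (m n : nat) (A B : 'M[R]_(m, n)) : mxdot A B = mxdot B A.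
Proof. by rewrite /mxdot -mxtrace_tr trmx_mul trmxK. Qed.

Lemma mxdotDl (m n : nat) (A B C : 'M[R]_(m, n)) :
  mxdot (A + B) C = mxdot A C + mxdot B C.
Proof. by rewrite /mxdot mulmxDl linearD. Qed.

Lemma mxdotNl (m n : nat) (A B : 'M[R]_(m, n)) : mxdot (- A) B = - mxdot A B.
Proof. by rewrite /mxdot mulNmx linearN. Qed.

Lemma mxdotBl (m n : nat) (A B C : 'M[R]_(m, n)) :
  mxdot (A - B) C = mxdot A C - mxdot B C.
Proof. by rewrite /mxdot mulmxBl linearB. Qed.

Lemma mxdotZl (m n : nat) (a : R) (A B : 'M[R]_(m, n)) :
  mxdot (a *: A) B = a * mxdot A B.
Proof. by rewrite /mxdot -scalemxAl linearZ. Qed.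

Lemma mxdotBr (m n : nat) (A B C : 'M[R]_(m, n)) :
  mxdot C (A - B) = mxdot C A - mxdot C B.
Proof. by rewrite !(mxdotC C) mxdotBl. Qed.

Lemma mxdotZr (m n : nat) (a : R) (A B : 'M[R]_(m, n)) :
  mxdot A (a *: B) = a * mxdot A B.
Proof. by rewrite !(mxdotC A) mxdotZl. Qed.

Lemma mxdot_mull (m n p : nat) (A : 'M[R]_(m, n)) (B : 'M[R]_(n, p))
    (C : 'M[R]_(m, p)) :
  mxdot (A *m B) C = mxdot A (C *m B^T).
Proof. by rewrite /mxdot trmx_mul trmxK mulmxA. Qed.

Lemma mxdot_trmull (m n p : nat) (A : 'M[R]_(m, n)) (B : 'M[R]_(m, p))
    (C : 'M[R]_(n, p)) :
  mxdot (A^T *m B) C = mxdot B (A *m C).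
Proof. by rewrite /mxdot -mulmxA mxtrace_mulC trmx_mul mulmxA. Qed.

Lemma mxdot_subZ (m n : nat) (A B : 'M[R]_(m, n)) (k : R) :
  mxdot (A - k *: B) (A - k *: B) =
  mxdot A A - 2 * k * mxdot A B + k ^+ 2 * mxdot B B.
Proof.
by rewrite !(mxdotBl, mxdotBr, mxdotZl, mxdotZr) (mxdotC B A); ring.
Qed.

Lemma mxdot_rank1_qform (n : nat) (A : 'M[R]_n) (x : 'rV[R]_n) :
  mxdot A (x^T *m x) = qform A x.
Proof. by rewrite mxdotC mxdot_trmull mxdotC. Qed.

Lemma mxdot_rank1 (n : nat) (x y : 'rV[R]_n) :
  mxdot (x^T *m x) (y^T *m y) = mxdot x y ^+ 2.
Proof.
rewrite mxdot_trmull mulmxA [x *m y^T]mx11_scalar -trace_mx11 mul_scalar_mx.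
by rewrite mxdotZr -expr2.
Qed.

End FrobeniusProduct.

Section FrobeniusNorm.
Variable R : realDomainType.

Lemma mxdotrr_ge0 (m n : nat) (A : 'M[R]_(m, n)) : 0 <= mxdot A A.
Proof.
by rewrite mxdotE; do 2![apply: sumr_ge0 => ? _]; rewrite -expr2 sqr_ge0.
Qed.

Lemma mxdotrr_eq0 (m n : nat) (A : 'M[R]_(m, n)) : (mxdot A A == 0) = (A == 0).
Proof.
apply/eqP/eqP => [|->]; last by rewrite /mxdot mul0mx linear0.
rewrite mxdotE pair_bigA => /psumr_eq0P A0; apply/matrixP => i j; rewrite mxE.
apply/eqP; rewrite -sqrf_eq0 expr2 (A0 _ (i, j)) // => p _.
by rewrite -expr2 sqr_ge0.
Qed.

Lemma mxdotrr_gt0 (m n : nat) (A : 'M[R]_(m, n)) : (0 < mxdot A A) = (A != 0).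
Proof. by rewrite lt0r mxdotrr_eq0 mxdotrr_ge0 andbT. Qed.

End FrobeniusNorm.

Lemma exists_unit_multiple (R : rcfType) (m n : nat) (A : 'M[R]_(m, n)) : A != 0 ->
  exists a : R, mxdot (a *: A) (a *: A) = 1.
Proof.
rewrite -mxdotrr_gt0 => A_gt0; exists (Num.sqrt (mxdot A A))^-1.
by rewrite mxdotZl mxdotZr mulrA -invfM -expr2 sqr_sqrtr ?mulVf ?gt_eqF ?ltW.
Qed.

Lemma exists_row_ker (F : fieldType) (m n : nat) (A : 'M[F]_(m, n)) :
  (n < m)%N -> exists2 w : 'rV[F]_m, w != 0 & w *m A = 0.
Proof.
move=> lt_nm; have : kermx A != 0.
  by rewrite -mxrank_eq0 mxrank_ker subn_eq0 -ltnNge (leq_ltn_trans (rank_leq_col A)).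
by case/rowV0Pn => w /sub_kermxP wA w0; exists w.
Qed.

Lemma rowsub1_mul_tr (R : pzSemiRingType) (m n : nat) (f : 'I_m -> 'I_n) :
  injective f -> rowsub f 1%:M *m (rowsub f 1%:M)^T = 1%:M :> 'M[R]_m.
Proof.
move=> f_inj; rewrite mul_rowsub_mx mul1mx trmx_mxsub trmx1.
by apply/matrixP => i j; rewrite !mxE (inj_eq f_inj).
Qed.

Lemma mxsub_rowsub1 (R : pzSemiRingType) (m n : nat) (f : 'I_m -> 'I_n) (A : 'M[R]_n) :
  mxsub f f A = rowsub f 1%:M *m A *m (rowsub f 1%:M)^T.
Proof.
by rewrite -rowsubE trmx_mxsub trmx1 mulmx_colsub mulmx1 mxsubcr.
Qed.

(** * Spectrum of real symmetric matrices *)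

Lemma char_poly_simmx (F : fieldType) (n : nat) (P A B : 'M[F]_n) :
  P \in unitmx -> simmx_for P A B -> char_poly A = char_poly B.
Proof.
move=> uP /(simmxP uP) PA; rewrite /char_poly.
have PAX : map_mx polyC P *m char_poly_mx A = char_poly_mx B *m map_mx polyC P.
  by rewrite /char_poly_mx mulmxBr mulmxBl scalar_mxC -!map_mxM PA.
have := congr1 (fun M => \det M) PAX; rewrite !det_mulmx mulrC => /mulIf; apply.
by rewrite det_map_mx polyC_eq0 -unitfE -unitmxE.
Qed.

Lemma char_poly_diag_mx (R : comNzRingType) (n : nat) (d : 'rV[R]_n) :
  char_poly (diag_mx d) = \prod_(x <- [seq d 0 i | i : 'I_n]) ('X - x%:P).
Proof.
rewrite char_poly_trig ?diag_mx_is_trig // big_map big_enum /=.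
by apply: eq_bigr => i _; rewrite mxE eqxx.
Qed.

(* Over R[i] the spectral theorem gives a real spectrum, and two real matrices
   that are similar over R[i] are similar over R. *)
Lemma symmetric_diagonalizable (R : rcfType) (n : nat) (A : 'M[R]_n) :
  A^T = A -> diagonalizable A.
Proof.
move=> symA; pose f : {rmorphism R -> R[i]} := real_complex R.
have f_real m k (M : 'M[R]_(m, k)) : map_mx f M \is a realmx.
  by apply/mxOverP => i j; rewrite mxE /= /real_complex_def complex_real.
have realf m k (M : 'M[R[i]]_(m, k)) :
    M \is a realmx -> M = map_mx f (map_mx (@complex.Re R) M).
  move=> /mxOverP rM; apply/matrixP => i j; rewrite !mxE.
  by have := rM i j; case: (M i j) => a b; rewrite complex_real => /eqP->.
pose A' := map_mx f A.
have A'herm : A' \is hermsymmx.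
  apply: realsym_hermsym; last exact: f_real.
  by apply/is_hermitianmxP; rewrite expr0 scale1r map_mx_id // map_trmx symA.
have /hermitian_normalmx/orthomx_spectralP A'E := A'herm.
have uS := spectral_unit A'.
pose D := diag_mx (spectral_diag A').
have d_real : spectral_diag A' \is a realmx by exact: hermitian_spectral_diag_real.
have D_real : D \is a realmx.
  rewrite /D (realf _ _ _ d_real) -map_diag_mx; exact: f_real.
have [|P /= /andP[rP uP] PA] := real_similar _ (f_real _ _ A) D_real.
  exists (spectralmx A') => //.
  by apply/simmxP => //; rewrite [X in _ *m X = _]A'E !mulmxA mulmxV // mul1mx.
have uP' : map_mx (@complex.Re R) P \in unitmx by rewrite -(map_unitmx f) -realf.
exists (map_mx (@complex.Re R) P) => //; apply/diagonalizable_forPex.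
exists (map_mx (@complex.Re R) (spectral_diag A')).
apply/(simmxP uP')/(@map_mx_inj _ _ f); rewrite !map_mxM map_diag_mx -!realf //.
exact/simmxP.
Qed.

Lemma count_flatten_nseq (T : eqType) (s : seq T) (m : T -> nat) (x : T) :
  uniq s ->
  count_mem x (flatten [seq nseq (m y) y | y <- s]) = ((x \in s) * m x)%N.
Proof.
elim: s => //= y s IHs /andP[y_s uniq_s].
rewrite count_cat count_nseq /= IHs // in_cons [x == y]eq_sym.
by have [<-|] := eqVneq y x; rewrite // (negbTE y_s) mul1n addn0.
Qed.

Lemma sorted_flatten_nseq (disp : Order.disp_t) (T : porderType disp)
    (s : seq T) (m : T -> nat) :
  sorted <%O s -> sorted <=%O (flatten [seq nseq (m y) y | y <- s]).
Proof.
elim: s => //= x s IHs; rewrite (path_sortedE lt_trans) => /andP[/allP x_lt s_lt].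
rewrite (sorted_pairwise le_trans) pairwise_cat -!(sorted_pairwise le_trans).
rewrite IHs ?andbT //; apply/andP; split.
  apply/allrelP => y z /nseqP[-> _] /flattenP[_ /mapP[w ws ->] /nseqP[-> _]].
  exact/ltW/x_lt.
by case: (m x) => //= k; elim: k => //= k ->; rewrite lexx.
Qed.

Lemma eigs_prod_XsubC (R : rcfType) (n : nat) (A : 'M[R]_n) (s : seq R) :
  char_poly A = \prod_(x <- s) ('X - x%:P) -> eigs A = rev (sort <=%R s).
Proof.
move=> pE; have p0 : char_poly A != 0 by exact: monic_neq0 (char_poly_monic A).
have sorted_roots : sorted <%R (rootsR (char_poly A)) by exact: sorted_roots.
rewrite /eigs; congr rev; apply: le_sorted_eq.
- exact: sorted_flatten_nseq.
- exact: sort_sorted le_total _.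
rewrite perm_sym perm_sort perm_sym; apply/allP => x _; apply/eqP.
rewrite /= count_flatten_nseq ?(sorted_uniq lt_trans ltxx) //.
have -> : (x \in rootsR (char_poly A)) = (x \in s).
  by rewrite -(roots_on_rootsR p0) pE root_prod_XsubC.
rewrite pE mu_prod_XsubC; case: (boolP (x \in s)) => [|/count_memPn->] //.
by rewrite mul1n.
Qed.

Section SymmetricSpectrum.
Variables (R : rcfType) (n : nat) (A : 'M[R]_n).
Hypothesis symA : A^T = A.

Lemma symmetric_spectrum : exists (P : 'M[R]_n) (d : 'rV[R]_n),
  [/\ P \in unitmx, P *m A = diag_mx d *m P,
      char_poly A = \prod_(x <- [seq d 0 i | i : 'I_n]) ('X - x%:P) &
      eigs A = rev (sort <=%R [seq d 0 i | i : 'I_n])].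
Proof.
have [P uP /diagonalizable_forPex[d PA]] := symmetric_diagonalizable symA.
have charA := etrans (char_poly_simmx uP PA) (char_poly_diag_mx d).
by exists P, d; split=> //; [exact/simmxP | exact: eigs_prod_XsubC].
Qed.

Lemma size_eigs : size (eigs A) = n.
Proof.
have [P [d [_ _ _ ->]]] := symmetric_spectrum.
by rewrite size_rev size_sort size_map size_enum_ord.
Qed.

Lemma sorted_eigs : sorted >=%R (eigs A).
Proof.
have [P [d [_ _ _ ->]]] := symmetric_spectrum.
by rewrite rev_sorted (sort_sorted le_total).
Qed.

Lemma nth_eigs_le (i j : nat) :
  (i <= j)%N -> (j < n)%N -> (eigs A)`_j <= (eigs A)`_i.
Proof.
move=> le_ij lt_jn; apply: (sorted_leq_nth (rev_trans le_trans) lexx) => //.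
- exact: sorted_eigs.
- by rewrite inE size_eigs (leq_ltn_trans le_ij).
- by rewrite inE size_eigs.
Qed.

Lemma mem_eigs (a : R) : (a \in eigs A) = eigenvalue A a.
Proof.
have [P [d [_ _ charA ->]]] := symmetric_spectrum.
by rewrite eigenvalue_root_char charA root_prod_XsubC mem_rev mem_sort.
Qed.

Lemma eigs_diagonalization : exists2 P : 'M[R]_n,
  P \in unitmx & P *m A = diag_mx (\row_i (eigs A)`_i) *m P.
Proof.
have [P [d [uP PA _ eigsE]]] := symmetric_spectrum.
have szE : size (eigs A) == n by rewrite size_eigs.
have : perm_eq (Tuple szE) [tuple d 0 i | i < n].
  by rewrite /= eigsE perm_rev perm_sort perm_refl.
case/tuple_permP => s sE; exists (row_perm s P).
  by rewrite row_permE unitmx_mul unitmx_perm.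
apply/row_matrixP => i; rewrite !row_mul !row_diag_mx -!scalemxAl -!rowE mxE.
have -> : (eigs A)`_i = d 0 (s i).
  have /= -> := congr1 (fun t : seq R => t`_i) sE.
  by rewrite (nth_map i) ?size_enum_ord // nth_ord_enum tnth_mktuple.
by rewrite row_permEsub row_rowsub -row_mul PA row_mul row_diag_mx -scalemxAl -rowE.
Qed.

End SymmetricSpectrum.

(** * Courant-Fischer and eigenvalue comparison *)

Section Rayleigh.
Variables (R : rcfType) (m n : nat) (P : 'M[R]_(m, n)) (z : 'rV[R]_m).
Implicit Types (A : 'M[R]_n) (d : 'rV[R]_m) (c : R).

(* The rows of P are eigenvectors but need not be orthogonal. Still their Gram
   matrix commutes with diag_mx d, hence with its square root, which writes the
   form as a square. *)
Lemma qform_eigenvectors_ge0 A d :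
  A^T = A -> P *m A = diag_mx d *m P -> (forall i, z 0 i != 0 -> 0 <= d 0 i) ->
  0 <= qform A (z *m P).
Proof.
move=> symA PA d_ge0; pose S := diag_mx (\row_i Num.sqrt (d 0 i)).
pose G := P *m P^T.
have dG : diag_mx d *m G = G *m diag_mx d.
  by rewrite mulmxA -PA -mulmxA -{1}symA -trmx_mul PA trmx_mul tr_diag_mx mulmxA.
have SG : S *m G = G *m S.
  apply/matrixP => i j; move/matrixP/(_ i j): dG.
  rewrite !mul_diag_mx !mul_mx_diag !mxE [RHS]mulrC => /eqP.
  rewrite -subr_eq0 -mulrBl mulf_eq0 subr_eq0 => /orP[/eqP->|/eqP->].
    by rewrite mulrC.
  by rewrite mulr0 mul0r.
have zd : z *m diag_mx d = z *m S *m S.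
  apply/rowP => i; rewrite !mul_mx_diag !mxE -mulrA -expr2.
  have [->|zi] := eqVneq (z 0 i) 0; first by rewrite !mul0r.
  by rewrite sqr_sqrtr ?d_ge0.
rewrite /qform -mulmxA PA mulmxA zd 2!mxdot_mull tr_diag_mx -/S.
rewrite -(mulmxA z) -/G -(mulmxA z).
by rewrite -SG !mulmxA -mxdot_mull mxdotrr_ge0.
Qed.

Lemma qform_eigenvectors_ge A d c :
  A^T = A -> P *m A = diag_mx d *m P -> (forall i, z 0 i != 0 -> c <= d 0 i) ->
  c * mxdot (z *m P) (z *m P) <= qform A (z *m P).
Proof.
move=> symA PA c_le.
rewrite -subr_ge0 /qform -mxdotZl -mxdotBl -mul_mx_scalar -mulmxBr.
apply: (@qform_eigenvectors_ge0 _ (d - const_mx c)) => [||i /c_le].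
- by rewrite linearB /= symA tr_scalar_mx.
- by rewrite mulmxBr PA linearB /= diag_const_mx mulmxBl scalar_mxC.
- by rewrite !mxE subr_ge0.
Qed.

Lemma qform_eigenvectors_le A d c :
  A^T = A -> P *m A = diag_mx d *m P -> (forall i, z 0 i != 0 -> d 0 i <= c) ->
  qform A (z *m P) <= c * mxdot (z *m P) (z *m P).
Proof.
move=> symA PA c_ge; rewrite -lerN2 -mulNr /qform -mxdotNl -mulmxN.
apply: (@qform_eigenvectors_ge _ (- d)) => [||i /c_ge].
- by rewrite linearN /= symA.
- by rewrite mulmxN PA linearN mulNmx.
- by rewrite mxE lerN2.
Qed.

End Rayleigh.

Section CourantFischer.
Variables (R : rcfType) (n : nat) (A : 'M[R]_n).
Hypothesis symA : A^T = A.

Lemma exists_subspace_ge_eigs (k : nat) : (k < n)%N ->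
  exists2 U : 'M[R]_(k.+1, n), row_free U & forall w : 'rV[R]_k.+1,
    (eigs A)`_k * mxdot (w *m U) (w *m U) <= qform A (w *m U).
Proof.
move=> lt_kn; have [P uP PA] := eigs_diagonalization symA.
pose first := widen_ord lt_kn.
have first_inj : injective first by move=> i j [/val_inj].
have rowsubPA : rowsub first P *m A =
    diag_mx (\row_i (eigs A)`_(first i)) *m rowsub first P.
  rewrite mul_rowsub_mx PA !mul_diag_mx; apply/matrixP => i j.
  by rewrite !mxE.
exists (rowsub first P) => [|w].
  rewrite /row_free rowsubE mxrankMfree ?row_free_unit //.
  by apply/row_freeP; exists (rowsub first 1%:M)^T; exact: rowsub1_mul_tr.
apply: qform_eigenvectors_ge symA rowsubPA _ => i _; rewrite mxE.
by apply: (nth_eigs_le symA); rewrite //= -ltnS.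
Qed.

Lemma le_eigs_of_subspace (k : nat) (U : 'M[R]_(k.+1, n)) (c : R) : (k < n)%N ->
  row_free U ->
  (forall w : 'rV[R]_k.+1,
     c * mxdot (w *m U) (w *m U) <= qform A (w *m U)) ->
  c <= (eigs A)`_k.
Proof.
move=> lt_kn freeU c_le; have [P uP PA] := eigs_diagonalization symA.
pose V := U *m invmx P; pose first := widen_ord (ltnW lt_kn).
have [w w0] := exists_row_ker (colsub first V) (ltnSn k).
rewrite mulmx_colsub => /rowP wV0.
have wV_le i : (w *m V) 0 i != 0 -> (\row_i (eigs A)`_i) 0 i <= (eigs A)`_k.
  move=> wVi; rewrite mxE; apply: nth_eigs_le => //; rewrite leqNgt.
  apply: contraNN wVi => lt_ik; have := wV0 (Ordinal lt_ik).
  have firstE : first (Ordinal lt_ik) = i by exact: val_inj.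
  by rewrite [LHS]mxE [RHS]mxE firstE => ->.
have := c_le w; have -> : w *m U = w *m V *m P by rewrite /V !mulmxA mulmxKV.
move=> /le_trans/(_ (qform_eigenvectors_le symA PA wV_le)).
rewrite ler_pM2r // mxdotrr_gt0 mulmx_free_eq0 ?row_free_unit // mulmx_free_eq0 //.
by rewrite /row_free mxrankMfree // ?row_free_unit ?unitmx_inv.
Qed.

Lemma last_eig_le_qform (x : 'rV[R]_n) :
  (eigs A)`_n.-1 * mxdot x x <= qform A x.
Proof.
have [P uP PA] := eigs_diagonalization symA; rewrite -(mulmxKV uP x).
apply: qform_eigenvectors_ge symA PA _ => i _; rewrite mxE.
by apply: nth_eigs_le; rewrite // -ltnS prednK // (leq_ltn_trans _ (ltn_ord i)).
Qed.

Lemma exists_last_eig_qform : (0 < n)%N ->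
  exists2 y : 'rV[R]_n, mxdot y y = 1 & qform A y = (eigs A)`_n.-1.
Proof.
move=> n_gt0; have : (eigs A)`_n.-1 \in eigs A.
  by rewrite mem_nth // size_eigs ?prednK.
rewrite mem_eigs // => /eigenvalueP[v vA /exists_unit_multiple[a av1]].
exists (a *: v) => //.
by rewrite /qform -scalemxAl vA scalerA mulrC -scalerA mxdotZl av1 mulr1.
Qed.

Lemma exists_orthogonal_ge_eigs (k : nat) (W : 'M[R]_(k, n)) : (k < n)%N ->
  exists x : 'rV[R]_n,
    [/\ mxdot x x = 1, x *m W^T = 0 & (eigs A)`_k <= qform A x].
Proof.
move=> lt_kn; have [U freeU U_ge] := exists_subspace_ge_eigs lt_kn.
have [w w0 wUW] := exists_row_ker (U *m W^T) (ltnSn k).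
have [|a ax1] := @exists_unit_multiple _ _ _ (w *m U).
  by rewrite mulmx_free_eq0.
exists (a *: (w *m U)); split=> //.
  by rewrite -scalemxAl -mulmxA wUW scaler0.
by have := U_ge (a *: w); rewrite -!scalemxAl ax1 mulr1 scalemxAl.
Qed.

End CourantFischer.

Section EigenvalueComparison.
Variables (R : rcfType) (n : nat) (A : 'M[R]_n).
Hypothesis symA : A^T = A.

Lemma eigs_le_of_qform (B : 'M[R]_n) (c : R) (k : nat) : B^T = B -> (k < n)%N ->
  (forall x : 'rV[R]_n, qform A x <= qform B x + c * mxdot x x) ->
  (eigs A)`_k <= (eigs B)`_k + c.
Proof.
move=> symB lt_kn le_AB; have [U freeU U_ge] := exists_subspace_ge_eigs symA lt_kn.
rewrite -lerBlDr; apply: le_eigs_of_subspace freeU _ => // w.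
by rewrite mulrBl lerBlDr (le_trans (U_ge w)).
Qed.

Section Compression.
Variables (m : nat) (S : 'M[R]_(m, n)).
Hypothesis S_orthonormal : S *m S^T = 1%:M.

Let mxdot_compress (x y : 'rV[R]_m) : mxdot (x *m S) (y *m S) = mxdot x y.
Proof. by rewrite mxdot_mull -mulmxA S_orthonormal mulmx1. Qed.

Let qform_compress (x : 'rV[R]_m) :
  qform A (x *m S) = qform (S *m A *m S^T) x.
Proof. by rewrite /qform [LHS]mxdotC mxdot_mull mxdotC !mulmxA. Qed.

Lemma compression_sym : (S *m A *m S^T)^T = S *m A *m S^T.
Proof. by rewrite !trmx_mul trmxK symA mulmxA. Qed.

Lemma eigs_compression_le (k : nat) : (k < m)%N ->
  (eigs (S *m A *m S^T))`_k <= (eigs A)`_k.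
Proof.
move=> lt_km; have freeS : row_free S by apply/row_freeP; exists S^T.
have lt_kn : (k < n)%N by rewrite (leq_trans lt_km) // -(eqP freeS) rank_leq_col.
have [U freeU U_ge] := exists_subspace_ge_eigs compression_sym lt_km.
apply: (@le_eigs_of_subspace _ _ _ symA _ (U *m S)) => // [|w].
  by rewrite /row_free mxrankMfree.
by rewrite mulmxA mxdot_compress qform_compress.
Qed.

Lemma last_eig_le_compression : (0 < m)%N ->
  (eigs A)`_n.-1 <= (eigs (S *m A *m S^T))`_m.-1.
Proof.
move=> /(exists_last_eig_qform compression_sym)[y y1 <-].
have := last_eig_le_qform symA (y *m S).
by rewrite mxdot_compress qform_compress y1 mulr1.
Qed.

End Compression.
End EigenvalueComparison.

(** * Induced subgraphs and deleted loops *)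

Lemma adjmx_sym (R : nzRingType) (n : nat) (e : rel 'I_n) :
  symmetric e -> (adjmx R e)^T = adjmx R e.
Proof. by move=> syme; apply/matrixP => i j; rewrite !mxE syme. Qed.

Lemma adjmx_mxsub (R : nzRingType) (m n : nat) (e' : rel 'I_m) (e : rel 'I_n)
    (f : 'I_m -> 'I_n) :
  {mono f : i j / e' i j >-> e i j} -> adjmx R e' = mxsub f f (adjmx R e).
Proof. by move=> fe; apply/matrixP => i j; rewrite !mxE fe. Qed.

Lemma spread10_induced_le (R : rcfType) (m n : nat) (e' : rel 'I_m) (e : rel 'I_n)
    (f : 'I_m -> 'I_n) : (1 < m)%N -> symmetric e -> injective f ->
  {mono f : i j / e' i j >-> e i j} -> spread10 R e' <= spread10 R e.
Proof.
move=> m_gt1 syme f_inj fe; have symA := adjmx_sym R syme.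
rewrite /spread10 /lam (adjmx_mxsub R fe) mxsub_rowsub1.
have S_orthonormal := rowsub1_mul_tr R f_inj; apply: lerB.
  exact: eigs_compression_le.
exact: last_eig_le_compression (ltnW m_gt1).
Qed.

Definition loopless (n : nat) (e : rel 'I_n) : rel 'I_n :=
  [rel i j | (i != j) && e i j].

Lemma loopless_sym (n : nat) (e : rel 'I_n) : symmetric e -> symmetric (loopless e).
Proof. by move=> syme i j; rewrite /loopless /= eq_sym syme. Qed.

Lemma qform_adjmx_loopless (R : comNzRingType) (n : nat) (e : rel 'I_n) (x : 'rV[R]_n) :
  qform (adjmx R e) x =
  qform (adjmx R (loopless e)) x + \sum_i (e i i)%:R * x 0 i ^+ 2.
Proof.
have -> : adjmx R e = adjmx R (loopless e) + diag_mx (\row_i (e i i)%:R).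
  apply/matrixP => i j; rewrite !mxE /loopless /=.
  by case: eqVneq => [->|_]; rewrite ?add0r ?addr0.
rewrite /qform mulmxDr mxdotDl; congr (_ + _).
rewrite mxdotE big_ord1; apply: eq_bigr => i _.
by rewrite mul_mx_diag !mxE mulrAC mulrC expr2.
Qed.

Lemma spread10_loopless_ge (R : rcfType) (n : nat) (e : rel 'I_n) :
  (1 < n)%N -> symmetric e -> spread10 R e - 1 <= spread10 R (loopless e).
Proof.
move=> n_gt1 syme; have symA := adjmx_sym R syme.
have symL := adjmx_sym R (loopless_sym syme).
have loops_le (x : 'rV[R]_n) : \sum_i (e i i)%:R * x 0 i ^+ 2 <= mxdot x x.
  rewrite mxdotE big_ord1; apply: ler_sum => i _; rewrite -expr2.
  by rewrite ler_piMl ?sqr_ge0 // lern1 leq_b1.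
have loops_ge0 (x : 'rV[R]_n) : 0 <= \sum_i (e i i)%:R * x 0 i ^+ 2.
  by apply: sumr_ge0 => i _; rewrite mulr_ge0 ?sqr_ge0 ?ler0n.
have second_le : lam R e 2 <= lam R (loopless e) 2 + 1.
  apply: eigs_le_of_qform => // x.
  by rewrite (qform_adjmx_loopless e) mul1r lerD2l.
have last_le : lam R (loopless e) n <= lam R e n + 0.
  apply: eigs_le_of_qform => // [|x]; first by rewrite prednK // ltnW.
  by rewrite (qform_adjmx_loopless e) mul0r addr0 lerDl.
by move: second_le last_le; rewrite /spread10; lra.
Qed.

(** * Blowups of the closed path *)

Lemma exists_perm_comp (T : eqType) (n : nat) (f g : 'I_n -> T) :
  (forall c, #|[pred i | f i == c]| = #|[pred i | g i == c]|) ->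
  exists s : 'S_n, forall i, f i = g (s i).
Proof.
move=> card_fg; have : perm_eq [tuple f i | i < n] [tuple g i | i < n].
  have count_fibre (h : 'I_n -> T) c :
      count_mem c [tuple h i | i < n] = #|[pred i | h i == c]|.
    by rewrite count_map -sum1_count -sum1_card big_enum_cond.
  by apply/allP => c _; rewrite /= !count_fibre card_fg.
case/tuple_permP => s fE; exists s => i.
by have := congr1 (fun u : n.-tuple T => tnth u i) (val_inj fE); rewrite !tnth_mktuple.
Qed.

Lemma card_divn_fibre (m t : nat) (c : 'I_m) : (0 < t)%N ->
  #|[pred i : 'I_(m * t) | (i %/ t == c)%N]| = t.
Proof.
move=> t_gt0; have lt_block (b : 'I_t) : (c * t + b < m * t)%N.
  by rewrite -ltn_divLR // divnMDl // divn_small // addn0.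
pose h b := Ordinal (lt_block b).
have h_inj : injective h by move=> a b [/addnI/val_inj].
rewrite -[RHS]card_ord -(card_codom h_inj); apply: eq_card => i.
rewrite inE; apply/eqP/codomP => [ic|[b ->]].
  exists (Ordinal (ltn_pmod i t_gt0)); apply: val_inj.
  by rewrite /= -ic -divn_eq.
by rewrite /= divnMDl // divn_small // addn0.
Qed.

Definition balanced (m n t : nat) (f : 'I_n -> 'I_m) : Prop :=
  forall c, #|[pred i | f i == c]| = t.

Lemma blowup_compression (R : rcfType) (m n t : nat) (f : 'I_n -> 'I_m) (A : 'M[R]_m) :
  (0 < t)%N -> balanced t f ->
  exists2 S : 'M[R]_(m, n),
    S *m S^T = 1%:M & S *m mxsub f f A *m S^T = t%:R *: A.
Proof.
move=> t_gt0 balanced_f; pose N : 'M[R]_(n, m) := rowsub f 1%:M.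
have NN : N^T *m N = t%:R%:M.
  apply/matrixP => c d; rewrite !mxE mulrnAC -{1}(balanced_f c) -sumr_const.
  rewrite [RHS]big_mkcond; apply: eq_bigr => i _; rewrite !mxE inE.
  by case: eqVneq => [->|_]; rewrite ?mul1r ?mul0r.
pose s : R := (Num.sqrt t%:R)^-1.
have s2 : s * s * t%:R = 1.
  by rewrite -invfM -expr2 sqr_sqrtr ?ler0n // mulVf // pnatr_eq0 -lt0n.
have N_orthonormal : (s *: N^T) *m (s *: N) = 1%:M.
  by rewrite -scalemxAl -scalemxAr scalerA NN scale_scalar_mx s2.
exists (s *: N^T); first by rewrite linearZ /= trmxK.
rewrite mxsub_rowsub1 -/N linearZ /= trmxK -!scalemxAl -!scalemxAr scalerA.
rewrite !mulmxA NN -(mulmxA _ N^T) NN mul_scalar_mx mul_mx_scalar !scalerA.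
by rewrite s2 mul1r.
Qed.

Lemma sqr_sqrt2 (R : rcfType) : Num.sqrt 2 ^+ 2 = 2 :> R.
Proof. by rewrite sqr_sqrtr. Qed.

Lemma sqrt2_gt1 (R : rcfType) : 1 < Num.sqrt 2 :> R.
Proof. by rewrite -[ltLHS]sqrtr1 ltr_sqrt ?ltr1n. Qed.

Lemma sqrt2_lt2 (R : rcfType) : Num.sqrt 2 < 2 :> R.
Proof. by have := sqrt2_gt1 R; have := sqr_sqrt2 R; move: (Num.sqrt _) => s; nra. Qed.

Lemma eigenvalueZ (F : fieldType) (n : nat) (A : 'M[F]_n) (a b : F) :
  eigenvalue A a -> eigenvalue (b *: A) (b * a).
Proof.
move=> /eigenvalueP[v vA v0]; apply/eigenvalueP; exists v => //.
by rewrite -scalemxAr vA scalerA.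
Qed.

Lemma p4star_sym : symmetric p4star.
Proof.
by move=> a b; rewrite /p4star (andbC (a == 0)%N) (andbC (a == 3)%N) (orbC (a.+1 == b)).
Qed.

Definition p4star_rel : rel 'I_4 := fun i j => p4star i j.

Lemma p4star_rel_sym : symmetric p4star_rel.
Proof. by move=> i j; rewrite /p4star_rel p4star_sym. Qed.

(* Reversing the path splits the eigenvectors into symmetric (s = 1) and
   antisymmetric (s = -1) ones, of the form (1, a - 1, s (a - 1), s). *)
Lemma eigenvalue_p4star (F : fieldType) (s a : F) :
  s * s = 1 -> (a - 1) * (a - s) = 1 -> eigenvalue (adjmx F p4star_rel) a.
Proof.
move=> s2 aE; pose v := [:: 1; a - 1; s * (a - 1); s].
have a2 : a * (a - 1) = 1 + s * (a - 1) by apply/eqP; rewrite -subr_eq -mulrBl mulrC aE.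
apply/eigenvalueP; exists (\row_i v`_i); last first.
  by apply/eqP => /rowP/(_ ord0)/eqP; rewrite !mxE oner_eq0.
apply/rowP => j; rewrite !mxE !big_ord_recl big_ord0 !mxE /p4star_rel /p4star /=.
case: j => [[|[|[|[|//]]]] lt_j4] /=; try by ring.
- by rewrite a2; ring.
- by rewrite [RHS]mulrCA a2; ring: s2.
Qed.

Lemma eigs_p4star (R : rcfType) (t : R) : 0 < t ->
  eigs (t *: adjmx R p4star_rel) =
  [seq t * a | a <- [:: 2; Num.sqrt 2; 0; - Num.sqrt 2]].
Proof.
move=> t_gt0; set s := map _ _.
have s2 := sqr_sqrt2 R; have sqrt2_gt1 := sqrt2_gt1 R; have sqrt2_lt2 := sqrt2_lt2 R.
have symA : (t *: adjmx R p4star_rel)^T = t *: adjmx R p4star_rel.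
  by rewrite linearZ /= adjmx_sym //; exact: p4star_rel_sym.
have sorted_s : sorted >%R s by rewrite /= !ltr_pM2l //; lra.
have sub_s : {subset s <= eigs (t *: adjmx R p4star_rel)}.
  move=> _ /mapP[a as_ ->]; rewrite mem_eigs //; apply: eigenvalueZ.
  move: as_; rewrite !inE => /or4P[]/eqP->.
  - by apply: (eigenvalue_p4star (s := 1)); ring.
  - by apply: (eigenvalue_p4star (s := -1)); [ring | ring: s2].
  - by apply: (eigenvalue_p4star (s := 1)); ring.
  - by apply: (eigenvalue_p4star (s := -1)); [ring | ring: s2].
have uniq_s : uniq s by exact: (sorted_uniq (rev_trans lt_trans) ltxx).
have size_le : (size (eigs (t *: adjmx R p4star_rel)) <= size s)%N by rewrite size_eigs.
apply: (sorted_eq (rev_trans le_trans) ge_anti).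
- exact: sorted_eigs.
- by apply: sub_sorted sorted_s => x y /ltW.
rewrite perm_sym uniq_perm // ?(leq_size_uniq uniq_s sub_s) //.
by have [_] := uniq_min_size uniq_s sub_s size_le.
Qed.

Lemma p4star_blowupP (n t : nat) (e : rel 'I_n) : (0 < t)%N -> n = (4 * t)%N ->
  (exists s : 'S_n, forall i j, e i j = p4star_blowup t (s i) (s j)) <->
  (exists2 f : 'I_n -> 'I_4,
     balanced t f & {mono f : i j / e i j >-> p4star_rel i j}).
Proof.
move=> t_gt0 nE; subst n; pose block (i : 'I_(4 * t)) : 'I_4 := inord (i %/ t).
have blockE i : block i = (i %/ t)%N :> nat by rewrite inordK // ltn_divLR.
have balanced_block : balanced t block.
  move=> c; rewrite -[RHS](card_divn_fibre c t_gt0); apply: eq_card => i.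
  by rewrite !inE -val_eqE /= blockE.
split=> [[s eE]|[f balanced_f fe]].
  exists (fun i => block (s i)) => [c|i j]; last first.
    by rewrite /p4star_rel !blockE eE.
  by rewrite -[RHS](balanced_block c) -!sum1_card [RHS](reindex_inj (@perm_inj _ s)).
have [|s fs] := @exists_perm_comp _ _ f block.
  by move=> c; rewrite balanced_f balanced_block.
by exists s => i j; rewrite -fe /p4star_rel !fs !blockE.
Qed.

Lemma spread10_p4star_blowup_ge (R : rcfType) (n t : nat) (e : rel 'I_n)
    (f : 'I_n -> 'I_4) : (0 < t)%N -> balanced t f ->
  {mono f : i j / e i j >-> p4star_rel i j} ->
  (4 * t)%:R / Num.sqrt 2 <= spread10 R e.
Proof.
move=> t_gt0 balanced_f fe.
have symA : (adjmx R e)^T = adjmx R e.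
  by apply: adjmx_sym => i j; rewrite -!fe p4star_rel_sym.
have [S S_orthonormal] := blowup_compression (adjmx R p4star_rel) t_gt0 balanced_f.
rewrite -(adjmx_mxsub R fe) => AS.
have := eigs_compression_le symA S_orthonormal (isT : 1 < 4)%N.
have := last_eig_le_compression symA S_orthonormal (isT : 0 < 4)%N.
rewrite AS eigs_p4star ?ltr0n // /spread10 /lam /= => last_le second_ge.
have sqrt2_gt0 : 0 < Num.sqrt 2 :> R by rewrite sqrtr_gt0.
have -> : (4 * t)%:R / Num.sqrt 2 = 2 * (t%:R * Num.sqrt 2) :> R.
  by rewrite natrM; field: (sqr_sqrt2 R); rewrite gt_eqF.
by lra.
Qed.

(** * The spread inequality *)

Definition signmx (R : pzRingType) (n : nat) (e : rel 'I_n) : 'M[R]_n :=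
  \matrix_(i, j) (-1) ^+ ~~ e i j.

Section SignMatrix.
Variables (R : comNzRingType) (n : nat) (e : rel 'I_n).

Lemma signmxE : signmx R e = 2 *: adjmx R e - const_mx 1.
Proof. by apply/matrixP => i j; rewrite !mxE; case: (e i j) => /=; ring. Qed.

Lemma signmx_sqr (i j : 'I_n) : signmx R e i j * signmx R e i j = 1.
Proof. by rewrite mxE -expr2 sqrr_sign. Qed.

Lemma mxdot_signmx : mxdot (signmx R e) (signmx R e) = n%:R ^+ 2.
Proof.
rewrite mxdotE pair_bigA (eq_bigr (fun=> 1)) => [|[i j] _]; last first.
  exact: signmx_sqr.
by rewrite sumr_const card_prod card_ord natrM.
Qed.

Lemma qform_signmx (x : 'rV[R]_n) :
  qform (signmx R e) x =
  2 * qform (adjmx R e) x - mxdot x (const_mx 1) ^+ 2.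
Proof.
have onesE : const_mx 1 = (const_mx 1 : 'rV[R]_n)^T *m const_mx 1 :> 'M[R]_n.
  by apply/matrixP => i j; rewrite !mxE big_ord1 !mxE mulr1.
rewrite -mxdot_rank1 -onesE -!mxdot_rank1_qform signmxE mxdotBl mxdotZl.
by rewrite [mxdot (const_mx 1) _]mxdotC.
Qed.

End SignMatrix.

Section SpreadInequality.
Variables (R : rcfType) (n : nat) (e : rel 'I_n).
Hypotheses (n_gt1 : (1 < n)%N) (syme : symmetric e).
Local Notation B := (signmx R e).
Local Notation k := (n%:R / Num.sqrt 2 : R).

Let k_gt0 : 0 < k.
Proof. by rewrite divr_gt0 ?sqrtr_gt0 // ltr0n ltnW. Qed.

Lemma exists_spread10_defect : exists x y : 'rV[R]_n,
  let D := B - k *: (x^T *m x - y^T *m y) in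
  [/\ mxdot x x = 1, mxdot y y = 1, mxdot x (const_mx 1) = 0 &
      mxdot D D + 2 * k * mxdot y (const_mx 1) ^+ 2 <=
      4 * k * (k - spread10 R e)].
Proof.
have symA := adjmx_sym R syme.
have [x [x1 x_ones x_ge]] :=
  exists_orthogonal_ge_eigs symA (const_mx 1 : 'rV[R]_n) n_gt1.
have [y y1 y_eq] := exists_last_eig_qform symA (ltnW n_gt1).
have x_ones0 : mxdot x (const_mx 1) = 0 by rewrite /mxdot x_ones linear0.
exists x, y => D; split=> //; rewrite /D mxdot_subZ mxdot_signmx.
have -> : n%:R ^+ 2 = 2 * k ^+ 2.
  by rewrite expr_div_n sqr_sqrt2 mulrC divfK ?pnatr_eq0.
set C := x^T *m x - _; have C_le : mxdot C C <= 2.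
  rewrite /C !(mxdotBl, mxdotBr) !mxdot_rank1 x1 y1 (mxdotC y x).
  by have := sqr_ge0 (mxdot x y); lra.
have BC_ge : 2 * spread10 R e + mxdot y (const_mx 1) ^+ 2 <= mxdot B C.
  rewrite mxdotBr !mxdot_rank1_qform !qform_signmx x_ones0 y_eq.
  by move: x_ge; rewrite /spread10 /lam /=; lra.
have := ler_wpM2l (ltW k_gt0) BC_ge; have := ler_wpM2l (sqr_ge0 k) C_le.
by lra.
Qed.

Lemma spread10_le_sqrt2 : spread10 R e <= k.
Proof.
have [x [y [_ _ _ defect]]] := exists_spread10_defect.
have k4_gt0 : 0 < 4 * k by rewrite mulr_gt0.
rewrite -subr_ge0 -(pmulr_rge0 _ k4_gt0); apply: le_trans defect.
by rewrite addr_ge0 ?mxdotrr_ge0 // mulr_ge0 ?sqr_ge0 // mulr_ge0 // ltW.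
Qed.

Lemma spread10_eq_signmx : spread10 R e = k ->
  exists x y : 'rV[R]_n,
    [/\ B = k *: (x^T *m x - y^T *m y), mxdot x x = mxdot y y,
        mxdot x (const_mx 1) = 0 & mxdot y (const_mx 1) = 0].
Proof.
move=> eq_k; have [x [y [x1 y1 x_ones defect]]] := exists_spread10_defect.
exists x, y; rewrite x1 y1; move: defect; rewrite eq_k subrr mulr0.
set D := B - _; set Y := mxdot y _ => defect.
have D_ge0 : 0 <= mxdot D D by exact: mxdotrr_ge0.
have Y_ge0 : 0 <= 2 * k * Y ^+ 2 by rewrite mulr_ge0 ?sqr_ge0 // mulr_ge0 // ltW.
split=> //.
  by apply/eqP; rewrite -subr_eq0 -mxdotrr_eq0 -/D; apply/eqP; lra.
have /eqP : 2 * k * Y ^+ 2 = 0 by lra.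
by rewrite mulf_eq0 sqrf_eq0 (gt_eqF (mulr_gt0 _ k_gt0)) //= => /eqP.
Qed.

End SpreadInequality.

(** * The extremal graphs *)

(* In the sign matrix of P_4^* the columns of vertices 0 and 1 are (+,+,-,-) and
   (+,-,+,-); [p] and [q] record the signs of these two entries. *)
Definition p4_vertex (p q : bool) : 'I_4 := inord (2 * ~~ p + ~~ q).

Lemma p4_vertexE (p q : bool) : p4_vertex p q = (2 * ~~ p + ~~ q)%N :> nat.
Proof. by rewrite inordK //; case: p q => [] []. Qed.

Lemma eq_p4_vertex (p q : bool) (c : 'I_4) :
  (p4_vertex p q == c) = (p == (c < 2)%N) && (q == ~~ odd c).
Proof.
rewrite -val_eqE /= p4_vertexE.
by case: c => [[|[|[|[|//]]]] lt_c4]; case: p q => [] [].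
Qed.

Lemma p4star_vertex_sign (R : comNzRingType) (p q p' q' : bool) :
  let sign (b : bool) : R := (-1) ^+ (~~ b) in
  2 * sign (p4star_rel (p4_vertex p q) (p4_vertex p' q')) =
  sign p * sign p' + sign p * sign q' + sign q * sign p' - sign q * sign q'.
Proof.
rewrite /p4star_rel !p4_vertexE.
by case: p q p' q' => [] [] [] []; rewrite /p4star /=; ring.
Qed.

Lemma signmx_sym (R : pzRingType) (n : nat) (e : rel 'I_n) (i j : 'I_n) :
  symmetric e -> signmx R e i j = signmx R e j i.
Proof. by move=> syme; rewrite !mxE syme. Qed.

(* Here i0 carries a loop and j0 does not. The column of j0 is normalized to be
   positive at i0, since j0 may play the role of either vertex 1 or vertex 2. *)
Definition p4_position (n : nat) (e : rel 'I_n) (i0 j0 i : 'I_n) : 'I_4 :=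
  p4_vertex (e i i0) (e i j0 == e i0 j0).

Section ExtremalStructure.
Variables (R : realFieldType) (n : nat) (e : rel 'I_n) (k : R) (x y : 'rV[R]_n).
Hypotheses (n_gt0 : (0 < n)%N) (syme : symmetric e).
Local Notation B := (signmx R e).
Hypotheses (BE : B = k *: (x^T *m x - y^T *m y)) (normE : mxdot x x = mxdot y y)
  (x_ones : mxdot x (const_mx 1) = 0) (y_ones : mxdot y (const_mx 1) = 0).

Lemma sum_signmx_row (i : 'I_n) : \sum_j B i j = 0.
Proof.
have sum_dot (z : 'rV[R]_n) : \sum_j z 0 j = mxdot z (const_mx 1).
  by rewrite mxdotE big_ord1; apply: eq_bigr => j _; rewrite mxE mulr1.
rewrite BE; under eq_bigr do rewrite !mxE !big_ord1 !mxE.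
by rewrite -mulr_sumr sumrB -!mulr_sumr !sum_dot x_ones y_ones !mulr0 subrr mulr0.
Qed.

Lemma sum_signmx_diag : \sum_i B i i = 0.
Proof.
rewrite -/(\tr B) BE linearZ linearB /= !(mxtrace_mulC _^T).
by rewrite -!/(mxdot _ _) normE subrr mulr0.
Qed.

Lemma exists_diag_eq (b : bool) : exists i, e i i = b.
Proof.
have [i /eqP ei|no_i] := pickP [pred i | e i i == b]; first by exists i.
have sum_diag := sum_signmx_diag.
rewrite (eq_bigr (fun=> (-1) ^+ b)) in sum_diag; last first.
  by move=> i _; have := no_i i; rewrite mxE /=; case: (e i i) (b) => [] [].
move/eqP: sum_diag.
by rewrite sumr_const card_ord mulrn_eq0 signr_eq0 orbF -leqn0 leqNgt n_gt0.
Qed.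

Section LoopPair.
Variables i0 j0 : 'I_n.
Hypotheses (ei0 : e i0 i0) (ej0 : ~~ e j0 j0).

(* The 3 x 3 minor on rows i, i0, j0 and columns j, i0, j0 vanishes. *)
Lemma signmx_rank2 (i j : 'I_n) :
  2 * B i j = B i i0 * B j i0 + B i0 j0 * (B i i0 * B j j0 + B i j0 * B j i0)
    - B i j0 * B j j0.
Proof.
have entry a b : B a b = k * (x 0 a * x 0 b - y 0 a * y 0 b).
  by rewrite BE !mxE !big_ord1 !mxE.
have minor : B i j * (B i0 i0 * B j0 j0 - B i0 j0 * B j0 i0)
    - B i i0 * (B i0 j * B j0 j0 - B i0 j0 * B j0 j)
    + B i j0 * (B i0 j * B j0 i0 - B i0 i0 * B j0 j) = 0 by rewrite !entry; ring.
have Bi0 : B i0 i0 = 1 by rewrite mxE ei0.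
have Bj0 : B j0 j0 = -1 by rewrite mxE ej0.
move: minor; rewrite !(signmx_sym _ i0 j syme) !(signmx_sym _ j0 _ syme) Bi0 Bj0.
by rewrite mul1r signmx_sqr; lra.
Qed.

Let pos := p4_position e i0 j0.

Let sign_p i : (-1) ^+ (~~ e i i0) = B i i0 :> R.
Proof. by rewrite mxE. Qed.

Let sign_q i : (-1) ^+ (e i j0 != e i0 j0) = B i0 j0 * B i j0 :> R.
Proof. by rewrite !mxE; case: (e i j0) (e i0 j0) => [] [] /=; ring. Qed.

Lemma p4_position_mono : {mono pos : i j / e i j >-> p4star_rel i j}.
Proof.
move=> i j.
have : 2 * (-1) ^+ (~~ p4star_rel (pos i) (pos j)) = 2 * B i j.
  rewrite p4star_vertex_sign !sign_p !sign_q signmx_rank2.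
  by ring: (signmx_sqr R e i0 j0).
rewrite mxE => /mulfI; rewrite pnatr_eq0 => /(_ isT).
by move/signr_inj/negb_inj.
Qed.

Lemma card_p4_position (c : 'I_4) : (4 * #|[pred i | pos i == c]|)%N = n.
Proof.
pose sp : R := (-1) ^+ (2 <= c)%N; pose sq : R := (-1) ^+ odd c.
have indicator i : (if pos i == c then 4 else 0 : R) =
    1 + sp * B i i0 + sq * (B i0 j0 * B i j0) + sp * sq * B i i.
  have -> : B i i = B i i0 * (B i0 j0 * B i j0).
    apply: (mulfI (_ : 2 != 0)); first by rewrite pnatr_eq0.
    by rewrite signmx_rank2; ring: (signmx_sqr R e i i0) (signmx_sqr R e i j0).
  rewrite -sign_p -sign_q eq_p4_vertex ltnNge /sp /sq.
  by case: (e i i0) (_ == _) (2 <= c)%N (odd c) => [] [] [] [] /=; ring.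
have sum_col j : \sum_i B i j = 0.
  by under eq_bigr do rewrite signmx_sym //; exact: sum_signmx_row.
apply/eqP; rewrite -(eqr_nat R) natrM -sum1_card natr_sum mulr_sumr big_mkcond.
under eq_bigr do rewrite inE mulr1 indicator.
rewrite !big_split /= -!mulr_sumr !sum_col sum_signmx_diag sumr_const card_ord.
by rewrite !mulr0 !addr0.
Qed.

End LoopPair.

Lemma extremal_p4star_blowup : exists t (f : 'I_n -> 'I_4),
  [/\ (0 < t)%N, n = (4 * t)%N, balanced t f &
      {mono f : i j / e i j >-> p4star_rel i j}].
Proof.
have [i0 ei0] := exists_diag_eq true; have [j0 /negbT ej0] := exists_diag_eq false.
pose f := p4_position e i0 j0; pose t := #|[pred i | f i == ord0]|.
have nE : n = (4 * t)%N by rewrite card_p4_position.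
exists t, f; split=> //; first by move: n_gt0; rewrite {1}nE; case: (t).
  by move=> c; apply/eqP; rewrite -(eqn_pmul2l (isT : 0 < 4)%N) -nE card_p4_position.
exact: p4_position_mono.
Qed.

End ExtremalStructure.

(** * Simple graphs *)

Section SimpleGraphs.
Variable R : rcfType.

Lemma spread10n_le (n : nat) : (1 < n)%N -> spread10n R n <= n%:R / Num.sqrt 2.
Proof.
move=> n_gt1; apply/bigmax_leP; split; first by rewrite divr_ge0 ?sqrtr_ge0.
move=> g /andP[_ /forallP symg]; apply: spread10_le_sqrt2 => // i j.
by have /forallP/(_ j)/eqP := symg i.
Qed.

Lemma spread10_le_spread10n (n : nat) (e : rel 'I_n) :
  simple_graph e -> spread10 R e <= spread10n R n.
Proof.
move=> simple_e; pose g := [ffun p : 'I_n * 'I_n => e p.1 p.2].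
have gE : (fun i j => g (i, j)) = e.
  by apply/funext => i; apply/funext => j; rewrite ffunE.
rewrite -[e in leLHS]gE.
apply: (@le_bigmax_cond _ _ _ 0 g _ (fun h => spread10 R (fun i j => h (i, j)))).
by rewrite gE.
Qed.

Lemma spread10n_ge (n t : nat) : (0 < t)%N -> (4 * t <= n)%N ->
  (4 * t)%:R / Num.sqrt 2 - 1 <= spread10n R n.
Proof.
move=> t_gt0 le_tn.
pose e (m : nat) : rel 'I_m := fun i j => p4star_blowup t i j.
have syme m : symmetric (e m) by move=> i j; rewrite /e /p4star_blowup p4star_sym.
have simple_e : simple_graph (loopless (e n)).
  apply/andP; split; apply/forallP => i; first by rewrite /loopless /= eqxx.
  by apply/forallP => j; rewrite loopless_sym.
apply: le_trans (spread10_le_spread10n simple_e).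
have t4_gt1 : (1 < 4 * t)%N by lia.
have [|f balanced_f fe] := (p4star_blowupP (e (4 * t)%N) t_gt0 erefl).1.
  by exists 1%g => i j; rewrite !perm1.
apply: (@le_trans _ _ (spread10 R (loopless (e (4 * t)%N)))).
  apply: le_trans (spread10_loopless_ge R t4_gt1 (syme _)).
  by rewrite lerD2r; exact: spread10_p4star_blowup_ge t_gt0 balanced_f fe.
apply: (@spread10_induced_le _ _ _ _ _ (widen_ord le_tn)) => //.
- exact: loopless_sym.
- by move=> i j [/val_inj].
Qed.

Lemma spread10n_ge_linear (n : nat) : (3 < n)%N ->
  n%:R / Num.sqrt 2 - 4 <= spread10n R n.
Proof.
move=> n_gt3; apply: le_trans (spread10n_ge (t := n %/ 4) _ _); last 2 first.
- by rewrite divn_gt0.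
- by rewrite mulnC leq_divM.
have n_le : n%:R - (4 * (n %/ 4))%:R <= 3 :> R.
  by rewrite lerBlDr -natrD ler_nat; lia.
rewrite lerBlDr addrAC -addrA -lerBlDl -mulrBl ler_pdivrMr ?sqrtr_gt0 //.
by have := sqrt2_gt1 R; lra.
Qed.

End SimpleGraphs.

Lemma cvg_spread10n (R : realType) :
  (fun n : nat => spread10n R n / n%:R) @ \oo --> (Num.sqrt (2 : R))^-1.
Proof.
pose r : R := (Num.sqrt 2)^-1.
apply: (@squeeze_cvgr _ _ _ _ (fun n => r - 4 * n%:R^-1) (fun=> r)).
- near=> n; have n_gt3 : (3 < n)%N by near: n; exists 4%N.
  have n_gt0 : (0 : R) < n%:R by rewrite ltr0n; lia.
  rewrite ler_pdivlMr // ler_pdivrMr // mulrBl mulfVK ?gt_eqF // ![r * _]mulrC.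
  by rewrite spread10n_ge_linear // spread10n_le // ltnW // ltnW.
- have : r - 4 * n%:R^-1 @[n --> \oo] --> r - 4 * 0.
    apply: cvgB; first exact: cvg_cst.
    by apply: cvgMl_tmp; rewrite -cvg_shiftS; exact: cvg_harmonic.
  by rewrite mulr0 subr0.
- exact: cvg_cst.
Unshelve. all: by end_near.
Qed.

Theorem theorem1p4 (R : realType) :
  (forall (n : nat) (e : rel 'I_n), (2 <= n)%N -> symmetric e ->
     lam R e 2 - lam R e n <= n%:R / Num.sqrt 2 /\
     (lam R e 2 - lam R e n = n%:R / Num.sqrt 2 <->
        exists t : nat, (0 < t)%N /\ n = (4 * t)%N /\
          exists s : 'S_n, forall i j : 'I_n,
            e i j = p4star_blowup t (s i) (s j)))
  /\
  (fun n : nat => spread10n R n / n%:R) @ \oo --> (Num.sqrt (2 : R))^-1.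
Proof.
split=> [n e n_gt1 syme|]; last exact: cvg_spread10n.
have spread_le := spread10_le_sqrt2 R n_gt1 syme; split=> //; split.
  move=> /(spread10_eq_signmx n_gt1 syme)[x [y [BE normE x_ones y_ones]]].
  have [t [f [t_gt0 nE balanced_f fe]]] :=
    extremal_p4star_blowup (ltnW n_gt1) syme BE normE x_ones y_ones.
  by exists t; do 2!split=> //; apply/p4star_blowupP => //; exists f.
move=> [t [t_gt0 [nE /(p4star_blowupP _ t_gt0 nE)[f balanced_f fe]]]].
apply/le_anti; rewrite spread_le /= [in leLHS]nE.
exact: spread10_p4star_blowup_ge t_gt0 balanced_f fe.
Qed.
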